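(* Let $\widetilde{\mathcal L}$ be the twisted $N=2$ superconformal algebra over $\mathbb C$. Then $\mathrm{Aut}(\widetilde{\mathcal L})=\mathbb C^*\rtimes\mathbb Z_4$; that is, $\mathrm{Aut}(\widetilde{\mathcal L})$ is isomorphic to a semidirect product of the multiplicative group $\mathbb C^*$ (as normal subgroup) by the cyclic group $\mathbb Z_4$.
   Context: The twisted $N=2$ superconformal algebra $\widetilde{\mathcal L}$ is the Lie superalgebra over $\mathbb C$ with basis $\{L_n,\,T_r,\,G_p,\,\mathfrak c \mid n\in\mathbb Z,\ r\in\frac12+\mathbb Z,\ p\in\frac12\mathbb Z\}$, where the $L_n,T_r,\mathfrak c$ span the even part $\widetilde{\mathcal L}_{\bar 0}$ and the $G_p$ span the odd part $\widetilde{\mathcal L}_{\bar 1}$. The non-vanishing super brackets of basis elements are (up to super skew-symmetry; $\mathfrak c$ is central) $[L_m,L_n]=(m-n)L_{m+n}+\frac{m^3-m}{12}\delta_{m+n,0}\mathfrak c$; $[L_m,T_r]=-rT_{r+m}$; $[T_r,T_s]=\frac r3\delta_{r+s,0}\mathfrak c$; $[L_m,G_p]=(\frac m2-p)G_{p+m}$; $[T_r,G_p]=G_{p+r}$; $[G_p,G_q]=(-1)^{2p}\big(2L_{p+q}+\frac13(p^2-\frac14)\delta_{p+q,0}\mathfrak c\big)$ if $p+q\in\mathbb Z$; $[G_p,G_q]=(-1)^{2p+1}(p-q)T_{p+q}$ if $p+q\in\frac12+\mathbb Z$. $\mathrm{Aut}(\widetilde{\mathcal L})$ is the group of bijective linear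 maps $\sigma:\widetilde{\mathcal L}\to\widetilde{\mathcal L}$ with $\sigma(\widetilde{\mathcal L}_{\bar0})=\widetilde{\mathcal L}_{\bar0}$, $\sigma(\widetilde{\mathcal L}_{\bar1})=\widetilde{\mathcal L}_{\bar1}$ and $\sigma([x,y])=[\sigma(x),\sigma(y)]$ for all $x,y$. $\mathbb C^*=\mathbb C\setminus\{0\}$ and $\mathbb Z_4=\mathbb Z/4\mathbb Z$. The factor $\mathbb C^*$ stands for the inner automorphism group $\mathrm{Inn}(\widetilde{\mathcal L})\cong\mathbb C^*$, the group generated by the automorphisms $\exp(l_0\,\mathrm{ad}\,L_0)$, $l_0\in\mathbb C^*$, where $\exp(l_0\,\mathrm{ad}\,L_0)$ multiplies each $x$ satisfying $[L_0,x]=-p\,x$ by $e^{-l_0p}$. *)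

(* Defs.v *)
From HB Require Import structures.
From mathcomp Require Import all_boot all_order all_algebra all_fingroup.
From mathcomp Require Import finmap.
(* The notations of monalg clash with those of MathComp-Analysis. *)
From mathcomp Require Import -(notations) monalg.
From mathcomp Require Import boolp classical_sets reals.
From mathcomp Require Import topology normedtype sequences trigo.
From mathcomp Require Import complex.

Set Implicit Arguments.
Unset Strict Implicit.
Unset Printing Implicit Defensive.

Import GRing.Theory.
Local Open Scope ring_scope.
Local Open Scope complex_scope.

Local Notation "{ 'free' F [ K ] }" := (@malg K F)
  (at level 0, F, K at level 2, format "{ 'free'  F [ K ] }").

Section Subgroups.
Variable G : groupType.
Local Open Scope group_scope.

Definition is_subgroup (H : set G) : Prop :=
  [/\ H 1, forall x y, H x -> H y -> H (x * y) & forall x, H x -> H x^-1].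

Definition generated (S : set G) : set G := smallest is_subgroup S.

End Subgroups.

Section NonzeroGroup.
Variable F : fieldType.

Record nonzero : Type := Nonzero { nzval :> F; nzvalP : nzval != 0 }.

HB.instance Definition _ := [isSub for nzval].
HB.instance Definition _ := [Choice of nonzero by <:].

Definition nz_one : nonzero := Nonzero (oner_neq0 F).
Definition nz_mul (x y : nonzero) : nonzero :=
  Nonzero (mulf_neq0 (nzvalP x) (nzvalP y)).
Definition nz_inv (x : nonzero) : nonzero :=
  Nonzero (invr_neq0 (nzvalP x)).

Fact nz_mulA : associative nz_mul.
Proof. by move=> x y z; apply: val_inj; rewrite /= mulrA. Qed.
Fact nz_mul1 : left_id nz_one nz_mul.
Proof. by move=> x; apply: val_inj; rewrite /= mul1r. Qed.
Fact nz_mulr1 : right_id nz_one nz_mul.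
Proof. by move=> x; apply: val_inj; rewrite /= mulr1. Qed.
Fact nz_mulV : left_inverse nz_one nz_inv nz_mul.
Proof. by move=> x; apply: val_inj; rewrite /= mulVf ?nzvalP. Qed.
Fact nz_mulrV : right_inverse nz_one nz_inv nz_mul.
Proof. by move=> x; apply: val_inj; rewrite /= mulfV ?nzvalP. Qed.

HB.instance Definition _ :=
  isGroup.Build nonzero nz_mulA nz_mul1 nz_mulr1 nz_mulV nz_mulrV.

End NonzeroGroup.

(** An action of [H] on [N] by group automorphisms (each [gact h] is
    invertible, with inverse [gact h^-1]), that is a homomorphism
    H -> Aut(N). *)
Section SemidirectProduct.
Local Open Scope group_scope.

Record group_action (H N : groupType) : Type := GroupAct {
  gact :> H -> N -> N;
  gact_morph : forall h, {morph gact h : m n / m * n};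
  gact_1 : forall n, gact 1 n = n;
  gact_M : forall h k n, gact (h * k) n = gact h (gact k n)
}.

(** N x| H, with (m, h) (n, k) = (m * phi_h(n), h * k). *)
Definition semidirect (H N : groupType) (phi : group_action H N) : Type :=
  (N * H)%type.

Variables (H N : groupType) (phi : group_action H N).
Local Notation sdT := (semidirect phi).

HB.instance Definition _ := Choice.on sdT.

Definition sd_one : sdT := (1, 1).
Definition sd_mul (x y : sdT) : sdT :=
  (x.1 * phi x.2 y.1, x.2 * y.2).
Definition sd_inv (x : sdT) : sdT :=
  (phi x.2^-1 x.1^-1, x.2^-1).

Fact gact_one h : phi h 1 = 1.
Proof. by apply: (mulgI (phi h 1)); rewrite -gact_morph !mulg1. Qed.

Fact sd_mulA : associative sd_mul.
Proof. by move=> x y z; rewrite /sd_mul /= gact_morph gact_M !mulgA. Qed.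
Fact sd_mul1 : left_id sd_one sd_mul.
Proof. by case=> n h; rewrite /sd_mul /= gact_1 !mul1g. Qed.
Fact sd_mulr1 : right_id sd_one sd_mul.
Proof. by case=> n h; rewrite /sd_mul /= gact_one !mulg1. Qed.
Fact sd_mulV : left_inverse sd_one sd_inv sd_mul.
Proof.
by case=> n h; rewrite /sd_mul /sd_inv /= -gact_morph !mulVg gact_one.
Qed.
Fact sd_mulrV : right_inverse sd_one sd_inv sd_mul.
Proof.
by case=> n h; rewrite /sd_mul /sd_inv /= -gact_M !mulgV gact_1 mulgV.
Qed.

HB.instance Definition _ :=
  isGroup.Build sdT sd_mulA sd_mul1 sd_mulr1 sd_mulV sd_mulrV.

Definition sd_inl (n : N) : sdT := (n, 1).

End SemidirectProduct.

(** [iL n], [iT k], [iG q] and [iC] index L_n, T_{k + 1/2}, G_{q / 2} and c. *)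
Inductive tn2_index : Type :=
  | iL of int | iT of int | iG of int | iC.

Definition tn2_index_encode (i : tn2_index) : int + int + int + unit :=
  match i with
  | iL n => inl (inl (inl n))
  | iT k => inl (inl (inr k))
  | iG q => inl (inr q)
  | iC => inr tt
  end.

Definition tn2_index_decode (s : int + int + int + unit) : tn2_index :=
  match s with
  | inl (inl (inl n)) => iL n
  | inl (inl (inr k)) => iT k
  | inl (inr q) => iG q
  | inr tt => iC
  end.

Fact tn2_index_encodeK : cancel tn2_index_encode tn2_index_decode.
Proof. by case. Qed.

HB.instance Definition _ :=
  Choice.copy tn2_index (can_type tn2_index_encodeK).

Definition tn2_odd (i : tn2_index) : bool := if i is iG _ then true else false.

Section TwistedN2.
Variable R : realType.
Local Notation C := R[i].

(** The complex vector space with basis [tn2_index]: the finitely supported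
    functions from [tn2_index] to C. *)
Definition tn2 : Type := {free C[tn2_index]}.

HB.instance Definition _ := GRing.Lmodule.on tn2.

Definition tn2_coef (i : tn2_index) (x : tn2) : C := mcoeff i x.

Definition bvec (i : tn2_index) : tn2 := mkmalgU i (1 : C).
Definition vL (n : int) : tn2 := bvec (iL n).
Definition vT (k : int) : tn2 := bvec (iT k).
Definition vG (q : int) : tn2 := bvec (iG q).
Definition vc : tn2 := bvec iC.

(** The complex numbers k + 1/2 and q / 2. *)
Definition rT (k : int) : C := k%:~R + 2^-1.
Definition pG (q : int) : C := q%:~R / 2.

Definition delta0 (z : C) : C := (z == 0)%:R.

(** With p = q1 / 2 and q = q2 / 2, the sum p + q is an integer iff q1 + q2 is
    even.  If q1 + q2 is odd then p + q = k + 1/2, where k is the Euclidean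
    quotient of q1 + q2 by 2; also (-1)^{2p} = (-1)^{q1}. *)
Definition brackG (q1 q2 : int) : tn2 :=
  let p := pG q1 in let q := pG q2 in
  if (2 %| q1 + q2)%Z then
    (-1) ^ q1 *: (2 *: vL ((q1 + q2) %/ 2)%Z
                  + (3^-1 * (p ^+ 2 - 4^-1) * delta0 (p + q)) *: vc)
  else
    ((-1) ^ (q1 + 1) * (p - q)) *: vT ((q1 + q2) %/ 2)%Z.

(** The cases [T_r, L_m], [G_p, L_m] and [G_p, T_r] are given by super
    skew-symmetry. *)
Definition brack_basis (i j : tn2_index) : tn2 :=
  match i, j with
  | iL m, iL n =>
      (m - n)%:~R *: vL (m + n)
      + ((m ^+ 3 - m)%:~R / 12 * delta0 (m + n)%:~R) *: vc
  | iL m, iT k => (- rT k) *: vT (k + m)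
  | iT k, iL m => rT k *: vT (k + m)
  | iT k, iT l => (rT k / 3 * delta0 (rT k + rT l)) *: vc
  | iL m, iG q => (m%:~R / 2 - pG q) *: vG (q + 2 * m)
  | iG q, iL m => (- (m%:~R / 2 - pG q)) *: vG (q + 2 * m)
  | iT k, iG q => vG (q + (2 * k + 1))
  | iG q, iT k => - vG (q + (2 * k + 1))
  | iG q1, iG q2 => brackG q1 q2
  | iC, _ | _, iC => 0
  end.

Definition brack (x y : tn2) : tn2 :=
  \sum_(i <- msupp x) \sum_(j <- msupp y)
     (tn2_coef i x * tn2_coef j y) *: brack_basis i j.

Definition tn2_part (b : bool) : set tn2 :=
  [set x | forall i, tn2_odd i != b -> tn2_coef i x = 0].

Definition is_automorphism (s : tn2 -> tn2) : Prop :=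
  [/\ bijective s, linear s,
      (s @` tn2_part false)%classic = tn2_part false,
      (s @` tn2_part true)%classic = tn2_part true
    & forall x y, s (brack x y) = brack (s x) (s y)].

Record autL : Type := AutL {
  autf :> tn2 -> tn2;
  autP : `[< is_automorphism autf >]
}.

HB.instance Definition _ := [isSub for autf].
HB.instance Definition _ := [Choice of autL by <:].

Lemma autfP (s : autL) : is_automorphism s.
Proof. exact/asboolP/autP. Qed.

Fact aut_id_subproof : `[< is_automorphism idfun >].
Proof.
apply/asboolP; split=> //; [by exists idfun | exact: image_id | exact: image_id].
Qed.

Fact aut_comp_subproof (s t : autL) : `[< is_automorphism (s \o t) >].
Proof.
have [sb sl s0 s1 sm] := autfP s; have [tb tl t0 t1 tm] := autfP t.
apply/asboolP; split.
- exact: bij_comp.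
- by move=> a x y /=; rewrite tl sl.
- by rewrite -image_comp t0 s0.
- by rewrite -image_comp t1 s1.
- by move=> x y /=; rewrite tm sm.
Qed.

Fact aut_inv_exists (s : autL) :
  exists g, [/\ is_automorphism g, cancel s g & cancel g s].
Proof.
have [[g sK gK] sl s0 s1 sm] := autfP s.
have image_g b : (s @` tn2_part b)%classic = tn2_part b ->
    (g @` tn2_part b)%classic = tn2_part b.
  move=> sb; rewrite -[X in (g @` X)%classic]sb image_comp.
  by rewrite (_ : g \o s = id) ?image_id //; apply/funext.
exists g; split; [split | exact: sK | exact: gK].
- by exists s.
- by move=> a x y; apply: (can_inj sK); rewrite sl !gK.
- exact: image_g.
- exact: image_g.
- by move=> x y; apply: (can_inj sK); rewrite sm !gK.
Qed.

Definition aut_inv_fun (s : autL) : tn2 -> tn2 :=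
  projT1 (cid (aut_inv_exists s)).

Fact aut_inv_subproof (s : autL) : `[< is_automorphism (aut_inv_fun s) >].
Proof. by apply/asboolP; rewrite /aut_inv_fun; case: cid => g []. Qed.

Definition aut_one : autL := AutL aut_id_subproof.
Definition aut_mul (s t : autL) : autL := AutL (aut_comp_subproof s t).
Definition aut_inv (s : autL) : autL := AutL (aut_inv_subproof s).

Fact aut_mulA : associative aut_mul.
Proof. by move=> s t u; apply: val_inj. Qed.
Fact aut_mul1 : left_id aut_one aut_mul.
Proof. by move=> s; apply: val_inj. Qed.
Fact aut_mulr1 : right_id aut_one aut_mul.
Proof. by move=> s; apply: val_inj. Qed.
Fact aut_mulV : left_inverse aut_one aut_inv aut_mul.
Proof.
move=> s; apply: val_inj; apply/funext => x /=.
by rewrite /aut_inv_fun; case: cid => g /= [].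
Qed.
Fact aut_mulrV : right_inverse aut_one aut_inv aut_mul.
Proof.
move=> s; apply: val_inj; apply/funext => x /=.
by rewrite /aut_inv_fun; case: cid => g /= [].
Qed.

HB.instance Definition _ :=
  isGroup.Build autL aut_mulA aut_mul1 aut_mulr1 aut_mulV aut_mulrV.

(** e^{a + b i} = e^a (cos b + i sin b) *)
Definition expC (z : C) : C :=
  let: a +i* b := z in (expR a)%:C * (cos b +i* sin b).

(** exp(l ad L_0) is determined by its values on the eigenvectors of ad L_0,
    which span the algebra. *)
Definition is_exp_ad_L0 (l : C) (s : tn2 -> tn2) : Prop :=
  forall (p : C) (x : tn2),
    brack (vL 0) x = (- p) *: x -> s x = expC (- (l * p)) *: x.

Definition innL : set autL :=
  generated [set s : autL | exists2 l : C, l != 0 & is_exp_ad_L0 l s].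

Lemma brack_bvec (i j : tn2_index) :
  brack (bvec i) (bvec j) = brack_basis i j.
Proof.
by rewrite /brack !msuppU oner_eq0 !big_seq_fset1 /tn2_coef !mcoeffUU mulr1 scale1r.
Qed.

End TwistedN2.

Arguments innL R _ : clear implicits.

(* Main.v *)
Require Import Defs.
From HB Require Import structures.
From mathcomp Require Import all_boot all_order all_algebra all_fingroup.
From mathcomp Require Import finmap ring zify.
From mathcomp Require Import -(notations) monalg.
From mathcomp Require Import boolp classical_sets reals.
From mathcomp Require Import exp trigo.
From mathcomp Require Import complex.

Import Order.TTheory GRing.Theory Num.Theory.
Local Open Scope group_scope.

Set Implicit Arguments.
Unset Strict Implicit.
Unset Printing Implicit Defensive.

(** An automorphism is controlled by what it does to [L_0].  The operator
    [ad L_0] is diagonalizable and grades the algebra by half-integers; each odd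
    component is the line spanned by some [G_p].

    Two families of automorphisms are visible on the basis: the grading
    automorphisms [grading_aut m], which multiply the component of index d = 2p
    by [m ^ d], and the flip [flip_aut], which sends [L_n] to [- L_(-n)],
    [T_r] to [T_(-r)], [G_p] to ['i G_(-p)] and the centre to its opposite.  The
    square of the flip is the parity automorphism, which is not a grading
    automorphism, the flip has order 4, and conjugation by it inverts the
    grading automorphisms.  Hence C^* x| Z_4 maps to the automorphism group, and
    the kernel is trivial by inspection of the action on [G_0] and [G_(1/2)].

    Surjectivity rests on the rigidity of [L_0].  If the image [h] of [L_0]
    under an automorphism had a component of positive degree, its top component
    would have to annihilate the top component of every [ad h]-eigenvector;
    applied to the images of the [G_p] this bounds the degrees of the odd part
    from above, which is absurd ([aut_L0_deg_le0]).  Composing with the flip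
    excludes negative degrees, so [h = a L_0 + g c].  Since [a] rescales the
    spectrum of [ad L_0], which is 1/2 Z, it is 1 or -1 ([aut_L0_sign]), and the
    flip reduces the second case to the first.  Then the automorphism preserves
    degrees, acts on every [G_p] by a scalar, and the brackets determine these
    scalars up to the choice of a torus element and a sign ([aut_fix_L0]); as
    the odd part generates the algebra ([aut_eq_odd]), the automorphism is a
    grading automorphism, up to parity.

    Finally exp(l ad L_0) is the grading automorphism with parameter e^(-l/2),
    and the complex exponential is onto C^*, so the inner automorphisms are
    exactly the grading automorphisms ([innL_grading]). *)

Local Open Scope ring_scope.
Local Open Scope complex_scope.

Lemma sum_seq_only (V : nmodType) (I : eqType) (r : seq I) (F : I -> V) k :
  uniq r -> (k \notin r -> F k = 0) ->
  (forall i, i \in r -> i != k -> F i = 0) -> \sum_(i <- r) F i = F k.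
Proof.
move=> ur Fk Fi; have [kr|kr] := boolP (k \in r).
  rewrite (bigD1_seq k kr ur) big1_seq /= ?addr0 // => i /andP[ik ir].
  exact: Fi.
rewrite Fk // big1_seq // => i /andP[_ ir]; apply: Fi => //.
by apply: contraNneq kr => <-.
Qed.

(** * The bracket as a bilinear map on finitely supported functions *)

Section LinearStructure.
Variable R : realType.
Local Notation C := R[i].
Local Notation tn2 := (tn2 R).
Local Notation bvec := (bvec R).
Local Notation "x @_ i" := (tn2_coef i x) (at level 3, i at level 2, format "x @_ i").

Lemma tcoefP (x y : tn2) : (forall i, x@_i = y@_i) -> x = y.
Proof. by move=> /malgP. Qed.

Lemma tcoef0 i : (0 : tn2)@_i = 0.
Proof. exact: mcoeff0. Qed.

Lemma tcoefD i (x y : tn2) : (x + y)@_i = x@_i + y@_i.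
Proof. exact: mcoeffD. Qed.

Lemma tcoefZ i a (x : tn2) : (a *: x)@_i = a * x@_i.
Proof. exact: mcoeffZ. Qed.

Lemma tcoef_sum i (I : Type) (r : seq I) P (F : I -> tn2) :
  (\sum_(j <- r | P j) F j)@_i = \sum_(j <- r | P j) (F j)@_i.
Proof. exact: (raddf_sum (mcoeff i)). Qed.

Lemma tcoef_bvec i j : (bvec i)@_j = (i == j)%:R.
Proof. by rewrite /tn2_coef mcoeffU. Qed.

Lemma tcoef_bvecii i : (bvec i)@_i = 1.
Proof. by rewrite tcoef_bvec eqxx. Qed.

Lemma tcoef_neq0 (x : tn2) i : (x@_i != 0) = (i \in msupp x).
Proof. exact: mcoeff_neq0. Qed.

Lemma tcoef_out (x : tn2) i : i \notin msupp x -> x@_i = 0.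
Proof. exact: mcoeff_outdom. Qed.

(** Reduces statements about linear maps to the basis vectors. *)
Lemma bvec_decomp (x : tn2) : x = \sum_(i <- msupp x) x@_i *: bvec i.
Proof.
apply: tcoefP => k; rewrite tcoef_sum (sum_seq_only (k := k)) ?fset_uniq //.
- by rewrite tcoefZ tcoef_bvecii mulr1.
- by move=> kx; rewrite tcoefZ tcoef_out // mul0r.
- by move=> i _ ik; rewrite tcoefZ tcoef_bvec (negPf ik) mulr0.
Qed.

Section Extension.
Variables (V : lmodType C) (F : tn2_index -> V).

Definition lext (x : tn2) : V := \sum_(i <- msupp x) x@_i *: F i.

(** Linearity of [lext] compares sums over the supports of [x], [y] and
    [a *: x + y]; summing over any larger finite set makes them commensurable. *)
Lemma lext_supset (d : {fset tn2_index}) (x : tn2) : (msupp x `<=` d)%fset ->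
  lext x = \sum_(i <- d) x@_i *: F i.
Proof.
move=> le; rewrite /lext (big_fset_incl _ le) // => i _ ix.
by rewrite tcoef_out // scale0r.
Qed.

Fact lext_is_linear : linear lext.
Proof.
move=> a x y; pose d := (msupp x `|` msupp y `|` msupp (a *: x + y))%fset.
rewrite !(@lext_supset d).
- rewrite scaler_sumr -big_split /=; apply: eq_bigr => i _.
  by rewrite tcoefD tcoefZ scalerDl scalerA.
- by rewrite /d; apply: fsubset_trans (fsubsetUl _ _); exact: fsubsetUr.
- by rewrite /d; apply: fsubset_trans (fsubsetUl _ _); exact: fsubsetUl.
- by rewrite /d; exact: fsubsetUr.
Qed.

HB.instance Definition _ := GRing.isLinear.Build C tn2 V *:%R lext lext_is_linear.

Lemma lext_bvec i : lext (bvec i) = F i.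
Proof.
by rewrite (@lext_supset [fset i]%fset) ?msuppU_le // big_seq_fset1 tcoef_bvecii scale1r.
Qed.

End Extension.

Lemma linear_bvec_ext (V : lmodType C) (f g : {linear tn2 -> V}) :
  (forall i, f (bvec i) = g (bvec i)) -> f =1 g.
Proof.
move=> fg x; rewrite (bvec_decomp x) !linear_sum; apply: eq_bigr => i _.
by rewrite !linearZ fg.
Qed.

Lemma brackE (x y : tn2) :
  brack x y = lext (fun i => lext (@brack_basis R i) y) x.
Proof.
rewrite /brack /lext; apply: eq_bigr => i _; rewrite scaler_sumr.
by apply: eq_bigr => j _; rewrite scalerA.
Qed.

Fact brackr_is_linear x : linear (@brack R x).
Proof.
move=> a y z; rewrite !brackE /lext scaler_sumr -big_split /=.
apply: eq_bigr => i _; rewrite -!/(lext _ _) linearP scalerDr !scalerA.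
by rewrite (mulrC a).
Qed.

HB.instance Definition _ x :=
  GRing.isLinear.Build C tn2 tn2 *:%R (@brack R x) (brackr_is_linear x).

(** The bracket with its arguments exchanged, so that linearity in the first
    argument can be carried by a structure on a one-argument function. *)
Definition brackl (y x : tn2) := brack x y.

Fact brackl_is_linear y : linear (brackl y).
Proof. by move=> a x z; rewrite /brackl !brackE linearP. Qed.

HB.instance Definition _ y :=
  GRing.isLinear.Build C tn2 tn2 *:%R (brackl y) (brackl_is_linear y).

Lemma brackDl (x y z : tn2) : brack (x + y) z = brack x z + brack y z.
Proof. exact: (linearD (brackl z)). Qed.

Lemma brackZl a (x z : tn2) : brack (a *: x) z = a *: brack x z.
Proof. exact: (linearZZ (brackl z)). Qed.

Lemma brackZr a (x z : tn2) : brack x (a *: z) = a *: brack x z.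
Proof. exact: linearZZ. Qed.

HB.instance Definition _ (s : autL R) :=
  GRing.isLinear.Build C tn2 tn2 *:%R (autf s)
    (let: And5 _ l _ _ _ := autfP s in l).

Lemma aut_brack (s : autL R) x y : s (brack x y) = brack (s x) (s y).
Proof. by have [] := autfP s. Qed.

Lemma aut_part (s : autL R) b x : tn2_part b x -> tn2_part b (s x).
Proof.
have [_ _ s0 s1 _] := autfP s.
by case: b => xb; [rewrite -s1 | rewrite -s0]; exists x.
Qed.

Lemma autMf (s t : autL R) x : (s * t)%g x = s (t x).
Proof. by []. Qed.
Lemma aut1f x : (1 : autL R)%g x = x.
Proof. by []. Qed.

Lemma aut_ext (s t : autL R) : s =1 t -> s = t.
Proof. by move=> st; apply: val_inj; apply/funext. Qed.

End LinearStructure.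

(** * The grading by [ad L_0] *)

Section Grading.
Variable R : realType.
Local Notation C := R[i].
Local Notation tn2 := (tn2 R).
Local Notation bvec := (bvec R).
Local Notation "x @_ i" := (tn2_coef i x) (at level 3, i at level 2, format "x @_ i").

(** Degrees are doubled so as to be integers: an element of degree d has
    [ad L_0]-eigenvalue -d/2. *)
Definition deg (i : tn2_index) : int :=
  match i with iL n => 2 * n | iT k => 2 * k + 1 | iG q => q | iC => 0 end.

Definition homog (d : int) (x : tn2) : Prop :=
  forall i, x@_i != 0 -> deg i = d.

Lemma homog0 d : homog d 0.
Proof. by move=> i; rewrite tcoef0 eqxx. Qed.

Lemma homogD d x y : homog d x -> homog d y -> homog d (x + y).
Proof.
move=> hx hy i; rewrite tcoefD; have [x0|/hx//] := eqVneq x@_i 0.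
by rewrite x0 add0r => /hy.
Qed.

Lemma homogZ d a x : homog d x -> homog d (a *: x).
Proof. by move=> hx i; rewrite tcoefZ mulf_eq0 negb_or => /andP[_ /hx]. Qed.

(** The central terms of the brackets carry a Kronecker delta, and have the
    right degree only when it does not vanish. *)
Lemma homogZ_if d a (b : bool) x : (b -> homog d x) -> homog d ((a * b%:R) *: x).
Proof.
by case: b => hx; rewrite ?mulr0 ?scale0r; [apply/homogZ/hx | apply: homog0].
Qed.

Lemma homog_bvec d i : deg i = d -> homog d (bvec i).
Proof. by move=> di j; rewrite tcoef_bvec; have [<-//|_] := i =P j; rewrite eqxx. Qed.

Lemma rTE (k : int) : rT R k = (2 * k + 1)%:~R / 2.
Proof.
rewrite /rT intrD intrM mulrDl mul1r (mulrC _ k%:~R).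
by rewrite mulfK // pnatr_eq0.
Qed.

Lemma rTD k l : rT R k + rT R l = (k + l + 1)%:~R.
Proof.
rewrite !rTE -mulrDl -intrD.
have -> : 2 * k + 1 + (2 * l + 1) = (k + l + 1) * 2 :> int by lia.
by rewrite intrM mulfK // pnatr_eq0.
Qed.

Lemma delta0_int (n : int) : delta0 (n%:~R : C) = (n == 0)%:R.
Proof. by rewrite /delta0 intr_eq0. Qed.

Lemma delta0_pG (q1 q2 : int) : delta0 (pG R q1 + pG R q2) = (q1 + q2 == 0)%:R.
Proof.
by rewrite /delta0 /pG -mulrDl -intrD mulf_eq0 invr_eq0 pnatr_eq0 orbF intr_eq0.
Qed.

Lemma brack_LL m n : brack_basis R (iL m) (iL n) =
  (m - n)%:~R *: vL R (m + n) + ((m ^+ 3 - m)%:~R / 12 * (m + n == 0)%:R) *: vc R.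
Proof. by rewrite /brack_basis delta0_int. Qed.

Lemma brack_TT k l : brack_basis R (iT k) (iT l) =
  (rT R k / 3 * (k + l + 1 == 0)%:R) *: vc R.
Proof. by rewrite /brack_basis rTD delta0_int. Qed.

Lemma brackG_even (q1 q2 n : int) : q1 + q2 = 2 * n -> brackG R q1 q2 =
  (-1) ^ q1 *: (2 *: vL R n + (3^-1 * (pG R q1 ^+ 2 - 4^-1) * (n == 0)%:R) *: vc R).
Proof.
move=> e; rewrite /brackG delta0_pG e {e}.
have -> : (2 %| 2 * n)%Z by lia.
have -> : ((2 * n) %/ 2)%Z = n by lia.
by have -> : (2 * n == 0) = (n == 0) by lia.
Qed.

Lemma brackG_odd (q1 q2 k : int) : q1 + q2 = 2 * k + 1 -> brackG R q1 q2 =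
  ((-1) ^ (q1 + 1) * (pG R q1 - pG R q2)) *: vT R k.
Proof.
move=> e; rewrite /brackG e.
have -> : (2 %| 2 * k + 1)%Z = false by lia.
by have -> : ((2 * k + 1) %/ 2)%Z = k by lia.
Qed.

Variant int_parity_spec (q : int) : Prop :=
  | IntEven n of q = 2 * n | IntOdd k of q = 2 * k + 1.

Lemma int_parityP q : int_parity_spec q.
Proof.
have [e|o] := boolP (2 %| q)%Z.
  by apply: (IntEven (n := (q %/ 2)%Z)); lia.
by apply: (IntOdd (k := (q %/ 2)%Z)); lia.
Qed.

(** The bracket is graded, which is what makes the maps [x |-> m ^ deg x]
    automorphisms and what isolates top-degree components below. *)
Lemma homog_brack_basis i j : homog (deg i + deg j) (brack_basis R i j).
Proof.
case: i j => [m|k|q|] [n|l|p|]; try exact: homog0.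
- rewrite brack_LL; apply: homogD; first by apply/homogZ/homog_bvec => /=; lia.
  by apply: homogZ_if => /eqP mn; apply: homog_bvec => /=; lia.
- by apply/homogZ/homog_bvec => /=; lia.
- by apply/homogZ/homog_bvec => /=; lia.
- by apply/homogZ/homog_bvec => /=; lia.
- rewrite brack_TT; apply: homogZ_if => /eqP kl; apply: homog_bvec => /=; lia.
- by apply/homog_bvec => /=; lia.
- by apply/homogZ/homog_bvec => /=; lia.
- by rewrite /= -scaleN1r; apply/homogZ/homog_bvec => /=; lia.
- rewrite /=; case: (int_parityP (q + p)) => [n|k] e.
    rewrite (brackG_even e); apply/homogZ/homogD.
      by apply/homogZ/homog_bvec => /=; lia.
    by apply/homogZ_if => /eqP n0; apply/homog_bvec => /=; lia.
  by rewrite (brackG_odd e); apply/homogZ/homog_bvec => /=; lia.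
Qed.

Lemma brack_L0_coef x i : (brack (vL R 0) x)@_i = - ((deg i)%:~R / 2) * x@_i.
Proof.
suff -> : brack (vL R 0) x = lext (fun i => (- ((deg i)%:~R / 2)) *: bvec i) x.
  rewrite /lext tcoef_sum (sum_seq_only (k := i)) ?fset_uniq //.
  - by rewrite !tcoefZ tcoef_bvecii mulr1 mulrC.
  - by move=> ix; rewrite tcoefZ tcoef_out // mul0r.
  - by move=> j _ ji; rewrite !tcoefZ tcoef_bvec (negPf ji) !mulr0.
apply: (linear_bvec_ext (f := [the {linear tn2 -> tn2} of brack (vL R 0)])) => j.
rewrite /= lext_bvec brack_bvec; case: j => [n|k|q|].
- rewrite brack_LL sub0r expr0n /= subr0 !mul0r scale0r addr0 add0r.
  by rewrite intrM intrN mulrAC divff ?mul1r // pnatr_eq0.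
- by rewrite /= rTE addr0.
- by rewrite /= mulr0 mul0r sub0r addr0.
- by rewrite /= mul0r oppr0 scale0r.
Qed.

(** Being homogeneous is an eigenvector condition for [ad L_0], so it can be
    transported along an automorphism once the image of [L_0] is known. *)
Lemma homog_L0 d x :
  homog d x <-> brack (vL R 0) x = (- (d%:~R / 2)) *: x.
Proof.
split=> [hx|e i xi].
  apply: tcoefP => i; rewrite brack_L0_coef tcoefZ.
  by have [->|/hx ->//] := eqVneq x@_i 0; rewrite !mulr0.
have /(congr1 (tn2_coef i)) := e; rewrite brack_L0_coef tcoefZ.
move=> /(mulIf xi) /oppr_inj /(mulIf _) -/(_ _)/intr_inj; apply.
by rewrite invr_eq0 pnatr_eq0.
Qed.

End Grading.

(** * Automorphisms permuting the basis up to scalars *)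

Lemma sign_opp (K : unitRingType) (q : int) : (-1) ^ (- q) = (-1) ^ q :> K.
Proof. by rewrite -exprz_inv invrN1. Qed.

Lemma sign_opp1 (K : unitRingType) (q : int) :
  (-1) ^ (- q + 1) = (-1) ^ (q + 1) :> K.
Proof. by rewrite !exprzDr ?unitrN1 // sign_opp. Qed.

(** The identities behind the compatibility of the flip with the brackets: a
    structure constant times the weight of the result equals the product of the
    weights of the two arguments times the structure constant at the reversed
    indices. *)
Section ScalarIdentities.
Variables (K : comNzRingType) (V : lmodType K).
Implicit Types (a b c d : K) (u v : V).

Lemma scale_match a a' c d u u' : u = u' -> a * c = d * a' ->
  a *: (c *: u) = d *: (a' *: u').
Proof. by move=> -> e; rewrite !scalerA e. Qed.

Lemma scale_match2 a a' b b' c d u u' v v' :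
    u = u' -> v = v' -> a * c = d * a' -> b * c = d * b' ->
  a *: (c *: u) + b *: (c *: v) = d *: (a' *: u' + b' *: v').
Proof. by move=> -> -> ea eb; rewrite scalerDr !scalerA ea eb. Qed.

Lemma scale_match_sign a b c d e u u' v v' :
    u = u' -> v = v' -> d = c ->
  e *: (a *: (c *: u) + b *: (c *: v)) = d *: (e *: (a *: u' + b *: v')).
Proof.
by move=> -> -> ->; rewrite !scalerDr !scalerA !(mulrC _ c) !mulrA (mulrC c).
Qed.

Lemma mulN1_flip a : a * -1 = (-1 * -1) * - a. Proof. by ring. Qed.
Lemma mulN1_flip2 a b b' : a * b * b' * -1 = (-1 * -1) * (- a * b * b').
Proof. by ring. Qed.
Lemma mulN1_flip3 a b b' : a * b * b' * -1 = (1 * 1) * (- a * b * b').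
Proof. by ring. Qed.
Lemma mulNN1_1 a : - a * 1 = (-1 * 1) * - - a. Proof. by ring. Qed.
Lemma mulN1_1 a : a * 1 = (1 * -1) * - a. Proof. by ring. Qed.
Lemma mul_flip_LG a b c : (a - b) * c = (-1 * c) * (- a - - b). Proof. by ring. Qed.
Lemma mul_flip_GL a b c : - (a - b) * c = (c * -1) * - (- a - - b).
Proof. by ring. Qed.
Lemma mul_flip_GG a b c d : d = -1 ->
  (c * (a - b)) * 1 = d * (c * (- a - - b)).
Proof. by move=> ->; ring. Qed.

End ScalarIdentities.

Section MonomialMaps.
Variable R : realType.
Local Notation C := R[i].
Local Notation tn2 := (tn2 R).
Local Notation bvec := (bvec R).
Local Notation "x @_ i" := (tn2_coef i x) (at level 3, i at level 2, format "x @_ i").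

(** By bilinearity. *)
Lemma brack_morph_basis (s : {linear tn2 -> tn2}) :
  (forall i j, s (brack_basis R i j) = brack (s (bvec i)) (s (bvec j))) ->
  forall x y, s (brack x y) = brack (s x) (s y).
Proof.
move=> sM x y.
pose f := [the {linear tn2 -> tn2} of brack (s x)].
apply: (linear_bvec_ext (f := [the {linear _ -> _} of s \o brack x])
  (g := [the {linear _ -> _} of f \o s])) => j; rewrite /= /f /=.
pose g := [the {linear tn2 -> tn2} of brackl (s (bvec j))].
apply: (linear_bvec_ext (f := [the {linear _ -> _} of s \o brackl (bvec j)])
  (g := [the {linear _ -> _} of g \o s])) => i; rewrite /= /brackl.
by rewrite brack_bvec sM.
Qed.

Definition monomial_map (w : tn2_index -> C) (p : tn2_index -> tn2_index) : tn2 -> tn2 :=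
  lext (fun i => w i *: bvec (p i)).

HB.instance Definition _ w p := GRing.Linear.on (monomial_map w p).

Lemma monomial_mapD w p x y :
  monomial_map w p (x + y) = monomial_map w p x + monomial_map w p y.
Proof. exact: linearD. Qed.

Lemma monomial_mapZ w p a x : monomial_map w p (a *: x) = a *: monomial_map w p x.
Proof. exact: linearZZ. Qed.

Lemma monomial_mapN w p x : monomial_map w p (- x) = - monomial_map w p x.
Proof. exact: linearN. Qed.

Lemma monomial_map0 w p : monomial_map w p 0 = 0.
Proof. exact: linear0. Qed.

Lemma monomial_map_bvec w p i : monomial_map w p (bvec i) = w i *: bvec (p i).
Proof. by rewrite /monomial_map lext_bvec. Qed.

Lemma monomial_map_coef w p x i : involutive p ->
  (monomial_map w p x)@_i = w (p i) * x@_(p i).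
Proof.
move=> pK; rewrite /monomial_map /lext tcoef_sum.
rewrite (sum_seq_only (k := p i)) ?fset_uniq //.
- by rewrite !tcoefZ pK tcoef_bvecii mulr1 mulrC.
- by move=> ix; rewrite tcoefZ tcoef_out // mul0r.
- move=> j _ jpi; rewrite !tcoefZ tcoef_bvec (_ : p j == i = false) ?mulr0 //.
  by apply: contra_neqF jpi => /eqP <-; rewrite pK.
Qed.

(** The inverse of [e_i |-> w_i e_(p i)] is the map of the same shape with
    weights [w_(p i)^-1], so bijectivity and stability of the two parts come for
    free and only the structure constants have to be compared. *)
Lemma monomial_automorphism (w : tn2_index -> C) p : involutive p ->
    (forall i, w i != 0) -> (forall i, tn2_odd (p i) = tn2_odd i) ->
    (forall i j, monomial_map w p (brack_basis R i j) =
                 (w i * w j) *: brack_basis R (p i) (p j)) ->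
  is_automorphism (monomial_map w p).
Proof.
move=> pK w0 podd wM; set s := monomial_map w p.
pose s' := monomial_map (fun i => (w (p i))^-1) p.
have sK : cancel s s'.
  move=> x; apply: tcoefP => i.
  by rewrite !monomial_map_coef // !pK mulrA mulVf ?mul1r.
have s'K : cancel s' s.
  move=> x; apply: tcoefP => i.
  by rewrite !monomial_map_coef // !pK mulrA mulfV ?mul1r.
have part v b x : tn2_part b x -> tn2_part b (monomial_map v p x).
  move=> xb i ib; rewrite monomial_map_coef //.
  by have /= -> := xb (p i); rewrite ?mulr0 // podd.
have image b : (s @` tn2_part b)%classic = tn2_part b.
  apply/seteqP; split=> [_ [x xb <-]|x xb]; first exact: part.
  by exists (s' x); [exact: part | rewrite s'K].
split; [by exists s' | exact: lext_is_linear | exact: image | exact: image | ].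
apply: (brack_morph_basis (s := [the {linear tn2 -> tn2} of s])) => i j /=.
rewrite [LHS]wM /s !monomial_map_bvec.
by rewrite brackZl brackZr brack_bvec scalerA.
Qed.

Lemma monomial_map_homog (m : C) d x : homog d x ->
  monomial_map (fun i => m ^ deg i) id x = m ^ d *: x.
Proof.
move=> hx; apply: tcoefP => i; rewrite monomial_map_coef // tcoefZ.
by have [->|/hx ->//] := eqVneq x@_i 0; rewrite !mulr0.
Qed.

Lemma grading_is_automorphism (m : nonzero C) :
  is_automorphism (monomial_map (fun i => nzval m ^ deg i) id).
Proof.
apply: monomial_automorphism => // [i|i j].
  by rewrite expfz_neq0 ?nzvalP.
by rewrite (monomial_map_homog _ (@homog_brack_basis R i j)) expfzDr ?nzvalP.
Qed.

(** The one-parameter family that will be identified with the inner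
    automorphisms: [m] acts on degree [d] by [m ^ d]. *)
Definition grading_aut (m : nonzero C) : autL R :=
  AutL (introT (asboolP _) (grading_is_automorphism m)).

Lemma grading_aut_homog m d x : homog d x ->
  grading_aut m x = nzval m ^ d *: x.
Proof. exact: monomial_map_homog. Qed.

Lemma grading_aut_bvec m i : grading_aut m (bvec i) = nzval m ^ deg i *: bvec i.
Proof. by apply: grading_aut_homog; apply: homog_bvec. Qed.

(** The flip reverses the grading.  On the Virasoro part it is the Chevalley
    involution [L_n |-> - L_(-n)]; the brackets [G_p, G_q] then force the scalar
    on the odd part to square to -1, whence its order 4.  The index [- k - 1]
    is that of [T_(-(k + 1/2))]. *)
Definition flip_index (i : tn2_index) : tn2_index :=
  match i with
  | iL n => iL (- n) | iT k => iT (- k - 1) | iG q => iG (- q) | iC => iC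
  end.

Definition flip_weight (i : tn2_index) : C :=
  match i with iL _ => -1 | iT _ => 1 | iG _ => 'i | iC => -1 end.

Lemma flip_indexK : involutive flip_index.
Proof. by case=> [n|k|q|] //=; congr (_ _); lia. Qed.

Lemma deg_flip i : deg (flip_index i) = - deg i.
Proof. by case: i => [n|k|q|] /=; lia. Qed.

Lemma im_neq0 : 'i != 0 :> C.
Proof. by rewrite eq_complex /= oner_eq0 andbF. Qed.

Lemma im_sqr : 'i * 'i = -1 :> C.
Proof. by rewrite -expr2 sqr_i. Qed.

Lemma flip_weight_neq0 i : flip_weight i != 0.
Proof. by case: i => *; rewrite /= ?oppr_eq0 ?oner_eq0 ?im_neq0. Qed.

Lemma rT_flip k : rT R (- k - 1) = - rT R k.
Proof. by rewrite !rTE -mulNr -intrN; congr (_%:~R / _); lia. Qed.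

Lemma pG_flip q : pG R (- q) = - pG R q.
Proof. by rewrite /pG intrN mulNr. Qed.

Local Notation flip := (monomial_map flip_weight flip_index).

Lemma flip_brack_basis i j :
  flip (brack_basis R i j) =
  (flip_weight i * flip_weight j) *: brack_basis R (flip_index i) (flip_index j).
Proof.
have eqb (f : int -> tn2_index) a b : a = b -> bvec (f a) = bvec (f b) by move->.
case: i j => [m|k|q|] [n|l|p|];
  try by rewrite /flip_index /brack_basis monomial_map0 scaler0.
- rewrite /flip_index !brack_LL monomial_mapD !monomial_mapZ !monomial_map_bvec.
  have -> : - m - - n = - (m - n) by lia.
  have -> : (- m) ^+ 3 - - m = - (m ^+ 3 - m) by lia.
  have -> : (- m - n == 0) = (m + n == 0) by lia.
  apply: scale_match2; [by apply: eqb; lia | by [] | |].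
    by rewrite intrN; exact: mulN1_flip.
  by rewrite intrN; exact: mulN1_flip2.
- rewrite /= monomial_mapZ monomial_map_bvec rT_flip.
  by apply: scale_match; [apply: eqb; lia | exact: mulNN1_1].
- rewrite /= monomial_mapZ monomial_map_bvec pG_flip.
  have -> : (- m)%:~R / 2 = - (m%:~R / 2) :> C by rewrite intrN mulNr.
  by apply: scale_match; [apply: eqb; lia | exact: mul_flip_LG].
- rewrite /= monomial_mapZ monomial_map_bvec rT_flip.
  by apply: scale_match; [apply: eqb; lia | exact: mulN1_1].
- rewrite /flip_index !brack_TT monomial_mapZ monomial_map_bvec rT_flip.
  have -> : (- k - 1 + (- l - 1) + 1 == 0) = (k + l + 1 == 0) by lia.
  by apply: scale_match; [by [] | exact: mulN1_flip3].
- rewrite /= monomial_map_bvec mul1r; congr (_ *: _); apply: eqb; lia.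
- rewrite /= monomial_mapZ monomial_map_bvec pG_flip.
  have -> : (- n)%:~R / 2 = - (n%:~R / 2) :> C by rewrite intrN mulNr.
  by apply: scale_match; [apply: eqb; lia | exact: mul_flip_GL].
- rewrite /= monomial_mapN monomial_map_bvec mulr1 scalerN; congr (- (_ *: _)).
  apply: eqb; lia.
- case: (int_parityP (q + p)) => [n|k] e.
    have e' : - q + - p = 2 * (- n) by lia.
    rewrite /flip_index /brack_basis (brackG_even R e) (brackG_even R e') sign_opp.
    rewrite monomial_mapZ monomial_mapD !monomial_mapZ !monomial_map_bvec.
    rewrite pG_flip sqrrN oppr_eq0.
    by apply: scale_match_sign; [| | exact: im_sqr].
  have e' : - q + - p = 2 * (- k - 1) + 1 by lia.
  rewrite /flip_index /brack_basis (brackG_odd R e) (brackG_odd R e').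
  rewrite monomial_mapZ monomial_map_bvec sign_opp1 !pG_flip.
  by apply: scale_match; [| exact: (mul_flip_GG _ _ _ im_sqr)].
Qed.

Lemma flip_is_automorphism : is_automorphism flip.
Proof.
apply: monomial_automorphism.
- exact: flip_indexK.
- exact: flip_weight_neq0.
- by case.
- exact: flip_brack_basis.
Qed.

Definition flip_aut : autL R :=
  AutL (introT (asboolP _) flip_is_automorphism).

End MonomialMaps.

(** * Rigidity of the image of [L_0] *)

Lemma exists_max (T : eqType) (s : seq T) (f : T -> int) (x : T) : x \in s ->
  exists2 y, y \in s & forall z, z \in s -> f z <= f y.
Proof.
elim: s x => // a [|b s] IHs x _.
  by exists a; [rewrite inE | move=> z; rewrite inE => /eqP->].
have [y ys ymax] := IHs b (mem_head _ _).
have [ay|ya] := leP (f a) (f y).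
  exists y; first by rewrite inE ys orbT.
  by move=> z; rewrite inE => /predU1P[->//|]; apply: ymax.
exists a; first exact: mem_head.
move=> z; rewrite inE => /predU1P[->//|/ymax zy].
exact: le_trans zy (ltW ya).
Qed.

Lemma sign_even (K : unitRingType) (n : int) : (-1) ^ (2 * n) = 1 :> K.
Proof. by rewrite -exprz_exp [(-1) ^ 2]sqrrN [1 ^+ 2]expr1n exp1rz. Qed.

Lemma linear_eq_cancel (K : fieldType) (V W : lmodType K) (f g : {linear V -> W})
    u v a k : a != 0 -> f v = g v -> f (a *: u + k *: v) = g (a *: u + k *: v) ->
  f u = g u.
Proof. by move=> a0 fv; rewrite !linearD !linearZZ fv => /addIr /(scalerI a0). Qed.

Section Rigidity.
Variable R : realType.
Local Notation C := R[i].
Local Notation tn2 := (tn2 R).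
Local Notation bvec := (bvec R).
Local Notation "x @_ i" := (tn2_coef i x) (at level 3, i at level 2, format "x @_ i").
Implicit Types (s t : autL R) (x y h : tn2).

(** Isolates one term of the double sum defining the bracket: the coefficient
    at [k] sees only the pairs of basis vectors whose bracket reaches [k]. *)
Lemma brack_coef_only h x k i0 j0 :
    (forall i j, h@_i != 0 -> x@_j != 0 -> (brack_basis R i j)@_k != 0 ->
       i = i0 /\ j = j0) ->
  (brack h x)@_k = h@_i0 * x@_j0 * (brack_basis R i0 j0)@_k.
Proof.
move=> only; rewrite /brack tcoef_sum (sum_seq_only (k := i0)) ?fset_uniq //.
- rewrite tcoef_sum (sum_seq_only (k := j0)) ?fset_uniq ?tcoefZ //.
    by move=> j0x; rewrite (tcoef_out j0x) mulr0 mul0r.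
  move=> j jx jj0; rewrite tcoefZ.
  have [-> //|hi] := eqVneq h@_i0 0; first by rewrite !mul0r.
  have [-> //|bi] := eqVneq (brack_basis R i0 j)@_k 0; first by rewrite mulr0.
  by have [] := only i0 j hi _ bi; rewrite ?tcoef_neq0 // => _ jj; rewrite jj eqxx in jj0.
- move=> i0h; rewrite tcoef_sum big1 // => j _.
  by rewrite tcoefZ (tcoef_out i0h) !mul0r.
- move=> i ih ii0; rewrite tcoef_sum big1_seq // => j /andP[_ jx]; rewrite tcoefZ.
  have [-> //|bi] := eqVneq (brack_basis R i j)@_k 0; first by rewrite mulr0.
  by have [] := only i j _ _ bi; rewrite ?tcoef_neq0 // => ii; rewrite ii eqxx in ii0.
Qed.

Lemma bvec_part i : tn2_part (tn2_odd i) (bvec i).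
Proof.
move=> j; rewrite tcoef_bvec; have [<-|//] := i =P j; by rewrite eqxx.
Qed.

Lemma part_coef b x i : tn2_part b x -> x@_i != 0 -> tn2_odd i = b.
Proof.
by move=> xb; apply: contra_neqP => /eqP ib; apply: xb.
Qed.

Lemma odd_indexP i : tn2_odd i = true -> exists q, i = iG q.
Proof. by case: i => // q _; exists q. Qed.

Lemma coef_witness x : x != 0 -> exists i, x@_i != 0.
Proof.
move=> x0; apply: contrapT => /forallNP xN; case/eqP: x0; apply: tcoefP => i.
by rewrite tcoef0; apply/eqP; apply: contrapT => /negP /xN.
Qed.

Lemma bvec_neq0 i : bvec i != 0.
Proof.
apply/eqP => /(congr1 (tn2_coef i)); rewrite tcoef_bvecii tcoef0.
by apply/eqP; rewrite oner_eq0.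
Qed.

(** Outside degree 0, where [L_0] and the centre meet, the even homogeneous
    components are lines. *)
Lemma even_deg_inj i j : ~~ tn2_odd i -> ~~ tn2_odd j -> deg i = deg j ->
  deg j != 0 -> i = j.
Proof. by case: i j => [m|k|q|] [n|l|p|] //= _ _ e d0;
  [congr iL | exfalso | exfalso | congr iT | exfalso ..]; lia. Qed.

(** If the top degree of [h] is positive, the product of the top components of
    [h] and [x] lies above the top degree of [x], hence is absent from [mu x]. *)
Lemma eigenvector_top h x mu i0 p :
    tn2_part false h -> tn2_part true x -> brack h x = mu *: x ->
    h@_i0 != 0 -> (forall i, h@_i != 0 -> deg i <= deg i0) -> 0 < deg i0 ->
    x@_(iG p) != 0 -> (forall q, x@_(iG q) != 0 -> q <= p) ->
  (brack_basis R i0 (iG p))@_(iG (deg i0 + p)) = 0.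
Proof.
move=> h0 x1 hx hi hmax i0_gt0 xp xmax.
have xtop : x@_(iG (deg i0 + p)) = 0.
  apply/eqP; apply: contraT => /xmax; rewrite gerDr leNgt i0_gt0 //.
have := congr1 (tn2_coef (iG (deg i0 + p))) hx.
rewrite (brack_coef_only (i0 := i0) (j0 := iG p)) ?tcoefZ ?xtop ?mulr0.
  by move/eqP; rewrite mulf_eq0 mulf_eq0 (negPf hi) (negPf xp) => /eqP.
move=> i j hi' xj bij; have [q jq] := odd_indexP (part_coef x1 xj); subst j.
have := homog_brack_basis bij => /= d.
have le1 := hmax i hi'; have le2 := xmax q xj.
split; last by congr iG; lia.
by apply: even_deg_inj; rewrite ?(part_coef h0 hi') ?(part_coef h0 hi) //; lia.
Qed.

Lemma autD s x y : s (x + y) = s x + s y.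
Proof. exact: linearD. Qed.

Lemma autZ s a x : s (a *: x) = a *: s x.
Proof. exact: linearZZ. Qed.

Lemma aut0 s : s 0 = 0.
Proof. exact: linear0. Qed.

Lemma aut_decomp s x : s x = \sum_(i <- msupp x) x@_i *: s (bvec i).
Proof.
rewrite {1}(bvec_decomp x) linear_sum; apply: eq_bigr => i _; exact: linearZZ.
Qed.

Lemma autK s x : (s^-1)%g (s x) = x.
Proof. by rewrite -autMf mulVg. Qed.

Lemma autVK s x : s ((s^-1)%g x) = x.
Proof. by rewrite -autMf mulgV. Qed.

Lemma aut_inj s : injective s.
Proof. exact: can_inj (autK s). Qed.

Lemma brack_L0_bvec i : brack (vL R 0) (bvec i) = (- ((deg i)%:~R / 2)) *: bvec i.
Proof. by apply/homog_L0; apply: homog_bvec. Qed.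

(** Suppose [h = s L_0] has positive top degree.  Each [s G_q] is an eigenvector
    of [ad h], so the top component of [h] kills that of [s G_q].  The bracket
    [T_r, G_p] never vanishes, and [L_n, G_p] vanishes only for p = n/2; so
    the degrees occurring in the odd elements [s G_q] are bounded above.  These
    elements span the odd part, which has unbounded degrees. *)
Lemma aut_L0_deg_le0 s i : (s (vL R 0))@_i != 0 -> deg i <= 0.
Proof.
move=> hi; rewrite leNgt; apply/negP => i_gt0.
set h := s (vL R 0) in hi *.
have h0 : tn2_part false h := aut_part s (@bvec_part (iL 0)).
have := hi; rewrite tcoef_neq0 => ih.
have [i0 i0h i0max] := exists_max deg ih.
have i0_gt0 : 0 < deg i0 := lt_le_trans i_gt0 (i0max _ ih).
rewrite -tcoef_neq0 in i0h.
have bounded q p : (s (vG R q))@_(iG p) != 0 -> p <= deg i0.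
  set x := s (vG R q) => xp.
  have x1 : tn2_part true x := aut_part s (@bvec_part (iG q)).
  have hx : brack h x = (- (q%:~R / 2)) *: x.
    by rewrite -aut_brack brack_L0_bvec autZ.
  have := xp; rewrite tcoef_neq0 => px.
  have [j jx jmax] := exists_max deg px.
  rewrite -tcoef_neq0 in jx.
  have [r jr] := odd_indexP (part_coef x1 jx); subst j.
  have pr : p <= r by exact: (jmax (iG p)).
  have : (brack_basis R i0 (iG r))@_(iG (deg i0 + r)) = 0.
    apply: (eigenvector_top h0 x1 hx) => //.
      by move=> k; rewrite tcoef_neq0; apply: i0max.
    by move=> k xk; apply: (jmax (iG k)); rewrite -tcoef_neq0.
  have := part_coef h0 i0h; clear -i0_gt0 pr.
  case: i0 i0_gt0 => [n|k|//|//] i0_gt0 _ /=.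
    rewrite [2 * n + r]addrC tcoefZ tcoef_bvecii mulr1 /pG -mulrBl -intrB => /eqP.
    rewrite mulf_eq0 invr_eq0 pnatr_eq0 orbF intr_eq0 => /eqP nr.
    by move: i0_gt0 => /=; lia.
  by rewrite [_ + r]addrC tcoef_bvecii => /eqP; rewrite oner_eq0.
(* An odd basis vector beyond the bound is not in the span of the images. *)
pose z := (s^-1)%g (vG R (deg i0 + 1)).
have z1 : tn2_part true z := aut_part s^-1%g (@bvec_part (iG (deg i0 + 1))).
have := congr1 (tn2_coef (iG (deg i0 + 1))) (autVK s (vG R (deg i0 + 1))).
rewrite -/z aut_decomp tcoef_sum tcoef_bvecii big1_seq.
  by move/esym/eqP; rewrite oner_eq0.
move=> j /andP[_]; rewrite -tcoef_neq0 => zj.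
have [q jq] := odd_indexP (part_coef z1 zj); subst j.
rewrite tcoefZ; apply/eqP; rewrite mulf_eq0; apply/orP; right.
by apply: contraT => /bounded; lia.
Qed.

Lemma flip_aut_coef x i :
  (flip_aut R x)@_i = flip_weight R (flip_index i) * x@_(flip_index i).
Proof. exact: (monomial_map_coef _ _ _ flip_indexK). Qed.

(** The lower bound is the upper bound for [s] followed by the flip. *)
Lemma aut_L0_deg0 s i : (s (vL R 0))@_i != 0 -> deg i = 0.
Proof.
move=> hi; apply/eqP; rewrite eq_le (aut_L0_deg_le0 hi) -oppr_le0 -deg_flip.
apply: (@aut_L0_deg_le0 (flip_aut R * s)%g).
by rewrite autMf flip_aut_coef flip_indexK mulf_neq0 ?flip_weight_neq0.
Qed.

Lemma brack_c x : brack (vc R) x = 0.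
Proof.
rewrite [LHS](linear_bvec_ext (f := [the {linear tn2 -> tn2} of brack (vc R)])
  (g := [the {linear tn2 -> tn2} of \0])) // => i.
by rewrite /= brack_bvec; case: i.
Qed.

Lemma tcoef_comb i (a b : C) x y : (a *: x + b *: y)@_i = a * x@_i + b * y@_i.
Proof. by rewrite tcoefD; congr (_ + _); exact: tcoefZ. Qed.

Lemma aut_L0 s : exists g : C,
  s (vL R 0) = (s (vL R 0))@_(iL 0) *: vL R 0 + g *: vc R.
Proof.
have h0 : tn2_part false (s (vL R 0)) := aut_part s (@bvec_part (iL 0)).
have hdeg := @aut_L0_deg0 s.
move: (s (vL R 0)) h0 hdeg => h h0 hdeg; exists (h@_iC).
apply: tcoefP => i; rewrite tcoef_comb [(vL R 0)@__]tcoef_bvec [(vc R)@__]tcoef_bvec.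
have [hi|hi] := eqVneq h@_i 0; last first.
  have := hdeg i hi; have := part_coef h0 hi.
  case: i hi => [n|k|q|] //= hi _ d; last by rewrite mulr0 mulr1 add0r.
    have -> : n = 0 by lia.
    by rewrite eqxx mulr1 mulr0 addr0.
  lia.
rewrite hi; case: (iL 0 =P i) => [e|_].
  by rewrite -e in hi *; rewrite hi mul0r mulr0 addr0.
by case: (iC =P i) => [e|_]; [rewrite -e in hi; rewrite hi|]; rewrite !mulr0 ?mul0r ?addr0.
Qed.

Lemma brack_comb (a b : C) x y z :
  brack (a *: x + b *: y) z = a *: brack x z + b *: brack y z.
Proof. by rewrite brackDl; congr (_ + _); exact: brackZl. Qed.

Lemma brack_L0c (a g : C) x :
  brack (a *: vL R 0 + g *: vc R) x = a *: brack (vL R 0) x.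
Proof.
by rewrite brack_comb brack_c scaler0 addr0.
Qed.

Lemma brack_aut_L0 s x :
  brack (s (vL R 0)) x = (s (vL R 0))@_(iL 0) *: brack (vL R 0) x.
Proof. by have [g {1}->] := aut_L0 s; exact: brack_L0c. Qed.

(** Transporting [L_0, x] = - d/2 x: the centre acts trivially, so [s] divides
    degrees by the coefficient of [L_0] in [s L_0]. *)
Lemma aut_L0_scale s d x i : homog d x -> (s x)@_i != 0 ->
  (s (vL R 0))@_(iL 0) * (deg i)%:~R = d%:~R.
Proof.
move=> /homog_L0 /(congr1 s); rewrite aut_brack brack_aut_L0 autZ.
move: (s (vL R 0))@_(iL 0) (s x) => a y e yi.
have : a * (brack (vL R 0) y)@_i = - (d%:~R / 2) * y@_i.
  exact: etrans (esym (tcoefZ i a _)) (etrans (congr1 (tn2_coef i) e) (tcoefZ i _ y)).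
rewrite brack_L0_coef mulrA.
move=> /(mulIf yi); rewrite mulrN => /oppr_inj; rewrite mulrA => /mulIf; apply.
by rewrite invr_eq0 pnatr_eq0.
Qed.

(** Write [a] for the coefficient.  A degree occurring in [s G_(1/2)] gives an
    integer [n] with [a n = 1], and a degree occurring in the preimage of
    [G_(1/2)] shows that [a] is itself an integer. *)
Lemma aut_L0_sign s : (s (vL R 0))@_(iL 0) = 1 \/ (s (vL R 0))@_(iL 0) = -1.
Proof.
set a := _@__.
have [i si] : exists i, (s (vG R 1))@_i != 0.
  apply: coef_witness; apply: contra_neq (bvec_neq0 (iG 1)) => e.
  by apply: (aut_inj (s := s)); rewrite e aut0.
have ai : a * (deg i)%:~R = 1.
  by apply: (@aut_L0_scale s 1 _ _ _ si); apply: homog_bvec.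
pose z := (s^-1)%g (vG R 1).
have [j zj] : exists j, z@_j != 0.
  apply: coef_witness; apply: contra_neq (bvec_neq0 (iG 1)) => e.
  by rewrite -[LHS](autVK s) -/z e aut0.
have aj : a = (deg j)%:~R.
  have : brack (vL R 0) z = (- (a / 2)) *: z.
    apply: (aut_inj (s := s)); rewrite aut_brack brack_aut_L0 -/a autZ autVK.
    by rewrite brack_L0_bvec scalerA mulrN mulrA mulr1.
  move=> /(congr1 (tn2_coef j)); rewrite brack_L0_coef tcoefZ.
  move=> /(mulIf zj) /oppr_inj /mulIf -> //.
  by rewrite invr_eq0 pnatr_eq0.
move: ai; rewrite aj -intrM => /(@intr_inj _ _ 1) ji.
have /eqP : (`|deg j| * `|deg i|)%N = 1%N by rewrite -abszM ji.
rewrite muln_eq1 => /andP[/eqP j1 _].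
have : deg j = 1 \/ deg j = -1 by lia.
by case=> ->; [left | right].
Qed.

Lemma rT0_neq0 : rT R 0 / 3 != 0.
Proof. by rewrite rTE mulr0 add0r !mulf_eq0 !invr_eq0 oner_eq0 !pnatr_eq0. Qed.

Lemma brack_T0T : brack (vT R 0) (vT R (-1)) = (rT R 0 / 3) *: vc R.
Proof. by rewrite brack_bvec brack_TT mulr1. Qed.

Lemma brack_GG0_odd (k : int) :
  brack (vG R (2 * k + 1)) (vG R 0) = ((2 * k + 1)%:~R / 2) *: vT R k.
Proof.
have e : 2 * k + 1 + 0 = 2 * k + 1 by rewrite addr0.
rewrite brack_bvec /brack_basis (brackG_odd R e).
have -> : 2 * k + 1 + 1 = 2 * (k + 1) by lia.
by rewrite sign_even mul1r [pG R 0]mul0r subr0.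
Qed.

Lemma brack_GG0_even (n : int) :
  brack (vG R (2 * n)) (vG R 0) =
  2 *: vL R n + (3^-1 * (pG R (2 * n) ^+ 2 - 4^-1) * (n == 0)%:R) *: vc R.
Proof.
have e : 2 * n + 0 = 2 * n by rewrite addr0.
by rewrite brack_bvec /brack_basis (brackG_even R e) sign_even scale1r.
Qed.

(** The odd part generates the algebra: [T_r] and [L_n] are obtained from
    brackets with [G_0], and the centre from [T_(1/2), T_(-1/2)]. *)
Lemma aut_eq_odd s t : (forall q, s (vG R q) = t (vG R q)) -> s = t.
Proof.
move=> stG.
have stT k : s (vT R k) = t (vT R k).
  have k0 : (2 * k + 1)%:~R / 2 != 0 :> C.
    rewrite mulf_eq0 invr_eq0 pnatr_eq0 orbF intr_eq0; lia.
  apply: (scalerI k0).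
  by rewrite -!autZ -brack_GG0_odd !aut_brack !stG.
have stc : s (vc R) = t (vc R).
  by apply: (scalerI rT0_neq0); rewrite -!autZ -brack_T0T !aut_brack !stT.
have stL n : s (vL R n) = t (vL R n).
  have two0 : (2 : C) != 0 by rewrite pnatr_eq0.
  have : s (brack (vG R (2 * n)) (vG R 0)) = t (brack (vG R (2 * n)) (vG R 0)).
    by rewrite !aut_brack !stG.
  rewrite brack_GG0_even.
  exact: (linear_eq_cancel (f := [the {linear tn2 -> tn2} of autf s])
    (g := [the {linear tn2 -> tn2} of autf t]) two0 stc).
apply: aut_ext => x.
apply: (linear_bvec_ext (f := [the {linear tn2 -> tn2} of autf s])
  (g := [the {linear tn2 -> tn2} of autf t])) => -[n|k|q|].
- exact: stL. - exact: stT. - exact: stG. - exact: stc.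
Qed.

End Rigidity.

(** * The semidirect product decomposition *)

Lemma expg_inverting (N G : groupType) (D : N -> G) (g : G) :
  (forall m, g * D m = D m^-1 * g)%g ->
  forall k m, (g ^+ k * D m = D (if odd k then m^-1 else m) * g ^+ k)%g.
Proof.
move=> gD; elim=> [|k IHk] m; first by rewrite mul1g mulg1.
rewrite expgS -mulgA IHk mulgA gD -mulgA /=.
by case: odd => //=; rewrite invgK.
Qed.

Lemma expfzM (K : fieldType) (a b : K) (q : int) : (a * b) ^ q = b ^ q * a ^ q.
Proof. by rewrite expfzMl mulrC. Qed.

Lemma mul_eq1_cancel (K : fieldType) (x y z w : K) :
  y != 0 -> x * y = z -> w * z = y -> x * w = 1.
Proof.
by move=> y0 <- e; apply: (mulIf y0); rewrite mul1r -[RHS]e mulrCA mulrA.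
Qed.

Lemma N1_neq1 (K : numDomainType) : -1 != 1 :> K.
Proof. by rewrite -subr_eq0 -opprD oppr_eq0 -mulr2n pnatr_eq0. Qed.

Section AutomorphismGroup.
Variable R : realType.
Local Notation C := R[i].
Local Notation tn2 := (tn2 R).
Local Notation bvec := (bvec R).
Local Notation "x @_ i" := (tn2_coef i x) (at level 3, i at level 2, format "x @_ i").
Local Notation flip := (flip_aut R).
Local Notation D := (@grading_aut R).
Implicit Types (s t : autL R) (x y : tn2) (m n : nonzero C).
Local Open Scope group_scope.

Lemma scale_bvec_inj i (a b : C) : (a *: bvec i = b *: bvec i)%R -> a = b.
Proof.
move=> /(congr1 (tn2_coef i)) e.
have := etrans (esym (tcoefZ i a (bvec i))) (etrans e (tcoefZ i b (bvec i))).
by rewrite tcoef_bvecii !mulr1.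
Qed.

Lemma aut_comb s (a b : C) x y : s (a *: x + b *: y)%R = (a *: s x + b *: s y)%R.
Proof. by rewrite autD; congr (_ + _)%R; exact: autZ. Qed.

Lemma grading_G m q : D m (vG R q) = (nzval m ^ q *: vG R q)%R.
Proof. exact: grading_aut_bvec. Qed.

Lemma flip_G q : flip (vG R q) = ('i *: vG R (- q))%R.
Proof. exact: monomial_map_bvec. Qed.

(** The square of the flip is the parity automorphism. *)
Lemma flip2_G q : (flip ^+ 2) (vG R q) = (- vG R q)%R.
Proof.
rewrite expg2 autMf flip_G autZ flip_G scalerA opprK.
by rewrite im_sqr scaleN1r.
Qed.

Lemma flip4 : flip ^+ 4 = 1.
Proof.
apply: aut_eq_odd => q; rewrite (expgnDr _ 2 2) autMf flip2_G.
by rewrite -scaleN1r autZ flip2_G scaleN1r opprK aut1f.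
Qed.

Lemma gradingM m n : D (m * n) = D m * D n.
Proof.
apply: aut_eq_odd => q; rewrite autMf !grading_G autZ grading_G scalerA.
by congr (_ *: _)%R; exact: expfzM.
Qed.

Lemma grading1 : D 1 = 1.
Proof. by apply: (mulgI (D 1)); rewrite -gradingM !mulg1. Qed.

Lemma gradingV m : D m^-1 = (D m)^-1.
Proof. by apply: (mulgI (D m)); rewrite -gradingM !mulgV grading1. Qed.

Lemma grading_inj : injective D.
Proof.
move=> m n e; apply: val_inj.
have := congr1 (fun s : autL R => s (vG R 1)) e; rewrite !grading_G.
by move=> /scale_bvec_inj.
Qed.

Lemma flip_grading m : flip * D m = D m^-1 * flip.
Proof.
apply: aut_eq_odd => q; rewrite !autMf grading_G flip_G !autZ flip_G grading_G.
by rewrite !scalerA mulrC; congr (_ * _ *: _)%R; rewrite /= exprz_inv opprK.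
Qed.

(** The generator of Z_4 acts by inversion on the torus, as the flip does on the
    grading automorphisms by conjugation. *)
Definition sign_act (h : 'Z_4) (n : nonzero C) : nonzero C :=
  if odd h then n^-1 else n.

Lemma nonzero_mulC m n : m * n = n * m.
Proof. by apply: val_inj; rewrite /= mulrC. Qed.

Lemma sign_act_morph h : {morph sign_act h : m n / m * n}.
Proof. by move=> m n; rewrite /sign_act; case: odd => //; rewrite invgM nonzero_mulC. Qed.

Lemma sign_act1 n : sign_act 1 n = n.
Proof. by []. Qed.

Lemma odd_Z4 (h k : 'Z_4) : odd (h * k)%g = odd h (+) odd k.
Proof. by case: h k => -[|[|[|[|//]]]] ? [[|[|[|[|//]]]] ?]. Qed.

Lemma sign_actM h k n : sign_act (h * k) n = sign_act h (sign_act k n).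
Proof.
by rewrite /sign_act odd_Z4; case: (odd h); case: (odd k) => //=; rewrite invgK.
Qed.

Definition sign_action : group_action 'Z_4 (nonzero C) :=
  GroupAct sign_act_morph sign_act1 sign_actM.

Lemma flipX_grading (k : nat) m :
  flip ^+ k * D m = D (if odd k then m^-1 else m) * flip ^+ k.
Proof. exact: (expg_inverting flip_grading). Qed.

Definition aut_of (x : semidirect sign_action) : autL R := D x.1 * flip ^+ x.2.

Lemma flipX_mod k : flip ^+ (k %% 4)%N = flip ^+ k.
Proof. by rewrite {2}(divn_eq k 4) expgnDr mulnC expgnA flip4 expg1n mul1g. Qed.

Lemma aut_ofM : {morph aut_of : x y / x * y}.
Proof.
move=> [m h] [n k]; rewrite /aut_of /=.
rewrite gradingM -!mulgA (mulgA (flip ^+ h)) flipX_grading -mulgA -expgnDr.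
by congr (_ * (_ * _)); rewrite -[RHS]flipX_mod.
Qed.

Lemma flipX_G0 (k : nat) : (flip ^+ k) (vG R 0) = ('i ^+ k *: vG R 0)%R.
Proof.
elim: k => [|k IHk]; first by rewrite expr0 scale1r.
rewrite expgS autMf IHk autZ flip_G oppr0.
by rewrite exprSr; exact: scalerA.
Qed.

(** On the line of [G_0], fixed by the grading automorphisms, the flip acts by
    the primitive fourth root of unity 'i. *)
Lemma aut_of_eq1 (x : semidirect sign_action) : aut_of x = 1 -> x = 1.
Proof.
case: x => m h e.
have e0 : ('i ^+ h = 1 :> C)%R.
  have := congr1 (fun s : autL R => s (vG R 0)) e.
  rewrite [aut_of _]/(D m * flip ^+ h) autMf flipX_G0 autZ grading_G expr0z scale1r.
  by rewrite aut1f -[RHS]scale1r => /scale_bvec_inj.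
have h0 : h = 1.
  have N1 := N1_neq1 C.
  apply: val_inj; case: h e0 {e} => -[|[|[|[|//]]]] //= _.
  - by move/eqP; rewrite expr1 eq_complex /= oner_eq0 andbF.
  - by move/eqP; rewrite expr2 im_sqr (negPf N1).
  - rewrite exprSr expr2 im_sqr mulN1r => /eqP.
    by rewrite eq_complex /= oppr0 eq_sym oner_eq0.
subst h; congr (_, _); apply: grading_inj.
by rewrite grading1 -e /aut_of /= mulg1.
Qed.

Lemma aut_of_inj : injective aut_of.
Proof.
move=> x y e; apply: (mulgI x^-1); rewrite mulVg; apply/esym/aut_of_eq1.
by apply: (mulgI (aut_of x)); rewrite -aut_ofM mulgA mulgV mul1g mulg1 e.
Qed.

Lemma homog_odd_vG q x : homog q x -> tn2_part true x -> x = (x@_(iG q) *: vG R q)%R.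
Proof.
move=> hx x1; apply: tcoefP => i; rewrite tcoefZ tcoef_bvec.
case: (iG q =P i) => [<-|iq]; first by rewrite mulr1.
rewrite mulr0; apply/eqP; apply: contraT => xi; case: iq.
by have := hx i xi; have [p ->] := odd_indexP (part_coef x1 xi) => /= ->.
Qed.

Lemma homog_even_vT k x : homog (2 * k + 1)%R x -> tn2_part false x ->
  x = (x@_(iT k) *: vT R k)%R.
Proof.
move=> hx x0; apply: tcoefP => i; rewrite tcoefZ tcoef_bvec.
case: (iT k =P i) => [<-|ik]; first by rewrite mulr1.
rewrite mulr0; apply/eqP; apply: contraT => xi; case: ik.
have := hx i xi; have := part_coef x0 xi.
by case: i {xi} => [n|l|p|] //= _ d; [lia | congr iT; lia | lia].
Qed.

(** The recurrence is run in both directions, which needs [c] invertible. *)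
Lemma int_geometric (K : fieldType) (b : int -> K) (c : K) : (c != 0)%R ->
  (forall q, b (q + 1) = c * b q)%R -> forall q, (b q = c ^ q * b 0)%R.
Proof.
move=> c0 bS; elim/int_rec => [|n IHn|n IHn]; first by rewrite expr0z mul1r.
  by rewrite -addn1 PoszD bS IHn expfzDr // expr1z mulrA [(c * _)%R]mulrC.
apply: (mulfI c0); rewrite -bS (_ : - n.+1%:Z + 1 = - n%:Z)%R; last by lia.
rewrite IHn mulrA; congr (_ * _)%R; rewrite (_ : - n%:Z = 1 + - n.+1%:Z)%R; last by lia.
by rewrite expfzDr // expr1z.
Qed.

(** Such an [s] preserves degrees, so it multiplies [G_(q/2)] by a scalar [b q]
    and [T_(k+1/2)] by a scalar [t k].  The brackets [T, G] make [b] geometric of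
    ratio [t 0]; the bracket of [T_(1/2)] and [T_(-1/2)] makes [s] fix the centre;
    the bracket of [G_0] with itself gives [b 0 ^ 2 = 1].  The sign [b 0] is the
    ambiguity of the parity automorphism. *)
Lemma aut_fix_L0 s : (s (vL R 0))@_(iL 0) = 1%R ->
  exists m, s = D m \/ s = D m * flip ^+ 2.
Proof.
move=> s1.
have shomog d x : homog d x -> homog d (s x).
  move=> hx i /(aut_L0_scale hx); rewrite s1 mul1r; exact: intr_inj.
pose b q := (s (vG R q))@_(iG q); pose t k := (s (vT R k))@_(iT k).
have sG q : s (vG R q) = (b q *: vG R q)%R.
  apply: homog_odd_vG; first by apply/shomog/homog_bvec.
  exact: (aut_part s (@bvec_part R (iG q))).
have sT k : s (vT R k) = (t k *: vT R k)%R.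
  apply: homog_even_vT; first by apply/shomog/homog_bvec.
  exact: (aut_part s (@bvec_part R (iT k))).
have tb k q : (t k * b q = b (q + (2 * k + 1)))%R.
  have e : brack (vT R k) (vG R q) = vG R (q + (2 * k + 1)) by rewrite brack_bvec.
  have := congr1 s e; rewrite aut_brack sT !sG brackZl brackZr e scalerA.
  by move=> /scale_bvec_inj.
have b_neq0 q : (b q != 0)%R.
  apply/eqP => bq; have /eqP[] := @bvec_neq0 R (iG q).
  by apply: (aut_inj (s := s)); rewrite aut0 sG bq scale0r.
have t0 : (t 0 != 0)%R.
  by have := b_neq0 1%R; have <- := tb 0%R 0%R; rewrite mulf_eq0 negb_or => /andP[].
have bq := int_geometric t0 (fun q => esym (tb 0%R q)).
have tt : (t 0 * t (-1) = 1)%R.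
  exact: (mul_eq1_cancel (b_neq0 0%R) (tb 0 0)%R (tb (-1) 1)%R).
have sc : s (vc R) = vc R.
  apply: (scalerI (rT0_neq0 R)); rewrite -autZ -brack_T0T aut_brack !sT.
  by rewrite brackZl brackZr scalerA tt scale1r.
have bb : (b 0 * b 0 = 1)%R.
  have := brack_GG0_even R 0; rewrite mulr0; move: (_ * _)%R => k e.
  have e0 : (2 *: vL R 0 + k *: vc R)@_(iL 0) = 2%R.
    by rewrite tcoef_comb !tcoef_bvec mulr0 addr0 mulr1.
  have : (s (brack (vG R 0) (vG R 0)))@_(iL 0) = 2%R.
    by rewrite e aut_comb tcoef_comb s1 sc tcoef_bvec mulr0 addr0 mulr1.
  rewrite aut_brack sG brackZl brackZr scalerA e => e2.
  have two0 : (2 != 0 :> C)%R by rewrite pnatr_eq0.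
  apply: (mulIf two0); rewrite mul1r -[RHS]e2.
  by rewrite -[in LHS]e0; exact: esym (tcoefZ _ _ _).
exists (Nonzero t0).
have /eqP := bb; rewrite -expr2 sqrf_eq1 => /orP[/eqP b1|/eqP b1]; [left | right];
  apply: aut_eq_odd => q; rewrite sG bq b1.
  by rewrite mulr1 grading_G.
by rewrite autMf flip2_G -[(- vG R q)%R]scaleN1r autZ grading_G scalerA mulrN1 mulN1r.
Qed.

(** Up to composition with the flip, the coefficient of [L_0] in [s L_0] is 1. *)
Lemma aut_of_surj s : exists u, aut_of u = s.
Proof.
suff [m [k ->]] : exists m k, s = D m * flip ^+ k.
  exists (m, inZp k); rewrite /aut_of /=; congr (_ * _); exact: flipX_mod.
have [s1|s1] := aut_L0_sign s.
  have [m [->|->]] := aut_fix_L0 s1; last by exists m, 2.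
  by exists m, 0; rewrite mulg1.
have : ((s * flip) (vL R 0))@_(iL 0) = 1%R.
  rewrite autMf (_ : flip (vL R 0) = (-1 *: vL R 0)%R); last first.
    exact: monomial_map_bvec.
  by rewrite autZ tcoefZ s1 mulrNN mulr1.
move=> /aut_fix_L0 [m e].
(* [flip ^+ 3] is the inverse of the flip. *)
have es : s = s * flip * flip ^+ 3 by rewrite -mulgA -expgS flip4 mulg1.
case: e => e; rewrite es e; first by exists m, 3.
by exists m, 5; rewrite -mulgA -expgnDr.
Qed.

End AutomorphismGroup.
(** * The complex exponential *)

Section ComplexExponential.
Variable R : realType.
Local Notation C := R[i].

Lemma expCD (z w : C) : expC (z + w) = expC z * expC w.
Proof.
case: z w => [a b] [c d]; rewrite /= expRD cosD sinD.
by apply/eqP; rewrite eq_complex /=; apply/andP; split; apply/eqP; ring.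
Qed.

Lemma expC0 : expC (0 : C) = 1.
Proof.
rewrite /= expR0 cos0 sin0; apply/eqP.
by rewrite eq_complex /= !mulr0 !mul0r !mulr1 subr0 addr0 !eqxx.
Qed.

Lemma expC_neq0 (z : C) : expC z != 0.
Proof.
apply/eqP => z0; have /eqP := expC0; rewrite -(subrr z) expCD z0 mul0r.
by rewrite eq_sym oner_eq0.
Qed.

Lemma expCMz (z : C) (q : int) : expC (z * q%:~R) = expC z ^ q.
Proof.
have nat_case (n : nat) : expC (z * n%:~R) = expC z ^+ n.
  elim: n => [|n IHn]; first by rewrite mulr0 expC0.
  by rewrite -addn1 PoszD intrD mulrDr mulr1 expCD IHn addn1 exprSr.
case: q => n; first exact: nat_case.
apply: (mulIf (expC_neq0 (z * n.+1%:~R))).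
rewrite -expCD NegzE intrN mulrN addNr expC0 nat_case -exprnN.
by rewrite mulVf // expf_neq0 ?expC_neq0.
Qed.

(** The arc cosine of [a], or its opposite according to the sign of [b]. *)
Lemma unit_circle_angle (a b : R) : a ^+ 2 + b ^+ 2 = 1 ->
  exists t, cos t = a /\ sin t = b.
Proof.
move=> ab; have a2 : a ^+ 2 <= 1 by rewrite -ab lerDl sqr_ge0.
have a1 : -1 <= a <= 1 by rewrite -ler_norml -(@expr_le1 _ 2) // real_normK ?num_real.
have sb : sin (acos a) = `|b|.
  by rewrite sin_acos // -ab addrAC subrr add0r sqrtr_sqr.
have ca : cos (acos a) = a by apply: acosK; rewrite in_itv.
have [b0|b0] := lerP 0 b.
  by exists (acos a); split=> //; rewrite sb ger0_norm.
exists (- acos a); split; first by rewrite cosN.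
by rewrite sinN sb ltr0_norm // opprK.
Qed.

(** Polar decomposition. *)
Lemma expC_surj (m : C) : m != 0 -> exists z, expC z = m.
Proof.
case: m => a b; rewrite eq_complex /= => ab0.
pose r := Num.sqrt (a ^+ 2 + b ^+ 2).
have s_gt0 : 0 < a ^+ 2 + b ^+ 2.
  rewrite lt_def addr_ge0 ?sqr_ge0 // andbT paddr_eq0 ?sqr_ge0 //.
  by rewrite !sqrf_eq0.
have r0 : 0 < r by rewrite sqrtr_gt0.
have r2 : r ^+ 2 = a ^+ 2 + b ^+ 2 by rewrite sqr_sqrtr // ltW.
have [|t [ct st]] := @unit_circle_angle (a / r) (b / r).
  by rewrite !expr_div_n -mulrDl -r2 divff // expf_neq0 // gt_eqF.
exists (ln r +i* t); rewrite /= lnK ?posrE // ct st.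
have rn : r != 0 by rewrite gt_eqF.
apply/eqP; rewrite eq_complex /= !mul0r subr0 addr0.
by rewrite ![r * _]mulrC !divfK ?eqxx.
Qed.

End ComplexExponential.

(** * Inner automorphisms *)

Section InnerAutomorphisms.
Variable R : realType.
Local Notation C := R[i].
Local Notation tn2 := (tn2 R).
Local Notation "x @_ i" := (tn2_coef i x) (at level 3, i at level 2, format "x @_ i").
Local Notation D := (@grading_aut R).

Lemma expC_half (l : C) (q : int) :
  expC (- (l * (q%:~R / 2))) = expC (- (l / 2)) ^ q.
Proof. by rewrite -expCMz; congr expC; rewrite mulNr mulrA mulrAC. Qed.

Lemma exp_ad_L0_grading (l : C) (s : autL R) : is_exp_ad_L0 l s ->
  s = D (Nonzero (expC_neq0 (- (l / 2)))).
Proof.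
move=> sl; apply: aut_eq_odd => q; rewrite grading_G.
rewrite (sl (q%:~R / 2)); last exact: brack_L0_bvec.
by rewrite expC_half.
Qed.

(** A nonzero eigenvector for the eigenvalue -p has all its degrees equal to
    2p, so the scalars of the two sides agree. *)
Lemma grading_exp_ad_L0 (l : C) (m : nonzero C) :
  expC (- (l / 2)) = nzval m -> is_exp_ad_L0 l (D m).
Proof.
move=> lm p x xp.
have [->|/coef_witness[i xi]] := eqVneq x 0; first by rewrite aut0 scaler0.
have ep j : x@_j != 0 -> p = (deg j)%:~R / 2.
  move=> xj; have := etrans (congr1 (tn2_coef j) xp) (tcoefZ j (- p) x).
  by rewrite brack_L0_coef => /(mulIf xj) /oppr_inj.
have hx : homog (deg i) x.
  move=> j /ep; rewrite (ep i xi) => /mulIf e; apply: (@intr_inj C).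
  by rewrite e // invr_eq0 pnatr_eq0.
rewrite (grading_aut_homog m hx); congr (_ *: _).
by rewrite (ep i xi) expC_half lm.
Qed.

Local Open Scope group_scope.

(** Every nonzero complex number has a logarithm, so every grading automorphism
    is one of the generators, except that the identity, whose logarithm may be
    0, is reached as the unit of the generated group. *)
Lemma innL_grading : innL R = range D.
Proof.
apply/seteqP; split.
  apply: smallest_sub => [|s [l _ /exp_ad_L0_grading ->]]; last first.
    by exists (Nonzero (expC_neq0 (- (l / 2))%R)).
  split; first by exists 1; rewrite ?grading1.
    by move=> _ _ [m _ <-] [n _ <-]; exists (m * n); rewrite ?gradingM.
  by move=> _ [m _ <-]; exists m^-1; rewrite ?gradingV.
move=> _ [m _ <-] H [[H1 _ _] Hgen].
have [z zm] := expC_surj (nzvalP m).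
have [z0|z0] := eqVneq z 0%R.
  have -> : m = 1 by apply: val_inj; rewrite /= -zm z0 expC0.
  by rewrite grading1.
apply: Hgen; exists (- (z * 2))%R.
  by rewrite oppr_eq0 mulf_neq0 ?pnatr_eq0.
by apply: grading_exp_ad_L0; rewrite mulNr opprK mulfK ?pnatr_eq0.
Qed.

End InnerAutomorphisms.

Local Close Scope ring_scope.

Theorem corollary1p6 (R : realType) :
  exists (phi : group_action 'Z_4 (nonzero R[i]))
         (f : semidirect phi -> autL R),
    [/\ {morph f : x y / x * y},
        bijective f
      & (f @` range (sd_inl phi))%classic = innL R].
Proof.
exists (sign_action R), (@aut_of R); split.
- exact: aut_ofM.
- have [g gK] := choice (@aut_of_surj R).
  exists g => // u; apply: aut_of_inj; exact: gK.
rewrite innL_grading; apply/seteqP; split=> [_ [_ [m _ <-] <-]|_ [m _ <-]].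
  by exists m; rewrite // /aut_of mulg1.
by exists (sd_inl (sign_action R) m); [exists m | rewrite /aut_of mulg1].
Qed.
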